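(* $\mathcal F=\mathcal N_1^-/\!\sim$ decomposes into exactly two $K_\epsilon$-orbits: $$\mathcal F=K_\epsilon\cdot[P_{12}^-]\ \amalg\ K_\epsilon\cdot[P_{13}^-],$$ where $$K_\epsilon\cdot[P_{12}^-]=\{[X]\in\mathcal F:(X|E_2)\neq0\}=\{[X]\in\mathcal F:(X|E_2)>0\},\qquad K_\epsilon\cdot[P_{13}^-]=\{[X]\in\mathcal F:(X|E_2)=0\}.$$
   Context: Octonions: $\mathbf O$ is the real division algebra of octonions with conjugation $x\mapsto\overline x$ and inner product $(x|y)=\mathrm{Re}(x\overline y)$. Jordan algebra: for $\xi_i\in\mathbb R$, $x_i\in\mathbf O$ let $$h^1(\xi_1,\xi_2,\xi_3;x_1,x_2,x_3)=\begin{pmatrix}\xi_1&\sqrt{-1}x_3&\sqrt{-1}\,\overline{x_2}\\ \sqrt{-1}\,\overline{x_3}&\xi_2&x_1\\ \sqrt{-1}x_2&\overline{x_1}&\xi_3\end{pmatrix}$$ (entries in $\mathbf O\otimes_{\mathbb R}\mathbb C$). $\mathcal J^1$ is the real vector space of all these matrices, with Jordan product $X\circ Y=\frac12(XY+YX)$, trace $\mathrm{tr}(X)=\xi_1+\xi_2+\xi_3$, bilinear form $(X|Y)=\mathrm{tr}(X\circ Y)=\sum\xi_i\eta_i+2(x_1|y_1)-2(x_2|y_2)-2(x_3|y_3)$. For $X=h^1(\xi_1,\xi_2,\xi_3;x_1,x_2,x_3)$, $X^{\times2}=h^1(\xi_2\xi_3-(x_1|x_1),\ \xi_3\xi_1+(x_2|x_2),\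 \xi_1\xi_2+(x_3|x_3);\ -\overline{x_2x_3}-\xi_1x_1,\ \overline{x_3x_1}-\xi_2x_2,\ \overline{x_1x_2}-\xi_3x_3)$. $E_i=h^1(\delta_{i1},\delta_{i2},\delta_{i3};0,0,0)$, $P_{12}^-=h^1(-1,1,0;0,0,1)$, $P_{13}^-=h^1(-1,0,1;0,1,0)$. $\mathrm F_{4(-20)}=\{g\in \mathrm{GL}_{\mathbb R}(\mathcal J^1): g(X\circ Y)=gX\circ gY\}$ and $K_\epsilon=\{g\in\mathrm F_{4(-20)}:gE_2=E_2\}$. $\mathcal N_1^-=\{X\in\mathcal J^1: X^{\times2}=0,\ \mathrm{tr}(X)=0,\ (E_1|X)<0\}$, which is an $\mathrm F_{4(-20)}$-orbit. For $X,Y\in\mathcal N_1^-$, $X\sim Y$ iff $Y=rX$ for some $r>0$; $[X]$ is the class of $X$; $\mathrm F_{4(-20)}$ acts on $\mathcal F$ by $g[X]=[gX]$. *)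

(* Defs.v *)
From HB Require Import structures.
From mathcomp Require Import all_boot all_order all_algebra.
From mathcomp Require Import complex ring lra.
From mathcomp Require Import boolp classical_sets reals.

Set Implicit Arguments.
Unset Strict Implicit.
Unset Printing Implicit Defensive.

Import Order.TTheory GRing.Theory Num.Theory.

Local Open Scope ring_scope.
Local Open Scope complex_scope.
Local Open Scope classical_set_scope.

Record octonion (A : Type) : Type :=
  Oct { o0 : A; o1 : A; o2 : A; o3 : A; o4 : A; o5 : A; o6 : A; o7 : A }.

Definition omap (A B : Type) (f : A -> B) (x : octonion A) : octonion B :=
  let: Oct a0 a1 a2 a3 a4 a5 a6 a7 := x in
  Oct (f a0) (f a1) (f a2) (f a3) (f a4) (f a5) (f a6) (f a7).

Section OctonionChoice.
Variable A : Type.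

Definition seq_of_oct (x : octonion A) : seq A :=
  let: Oct a0 a1 a2 a3 a4 a5 a6 a7 := x in [:: a0; a1; a2; a3; a4; a5; a6; a7].
Definition oct_of_seq (s : seq A) : option (octonion A) :=
  if s is [:: a0; a1; a2; a3; a4; a5; a6; a7]
  then Some (Oct a0 a1 a2 a3 a4 a5 a6 a7) else None.
Lemma seq_of_octK : pcancel seq_of_oct oct_of_seq. Proof. by case. Qed.

End OctonionChoice.

HB.instance Definition _ (A : choiceType) :=
  Choice.copy (octonion A) (pcan_type (@seq_of_octK A)).

Section Octonions.
Variable A : comNzRingType.
Implicit Types x y z : octonion A.

Definition ozero : octonion A := Oct 0 0 0 0 0 0 0 0.
Definition oopp x : octonion A := omap -%R x.
Definition oadd x y : octonion A :=
  let: Oct a0 a1 a2 a3 a4 a5 a6 a7 := x in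
  let: Oct b0 b1 b2 b3 b4 b5 b6 b7 := y in
  Oct (a0 + b0) (a1 + b1) (a2 + b2) (a3 + b3) (a4 + b4) (a5 + b5) (a6 + b6) (a7 + b7).
Definition oscale (c : A) x : octonion A := omap ( *%R c) x.

Lemma oaddA : associative oadd.
Proof. by do 3 case=> ? ? ? ? ? ? ? ?; congr Oct; apply: addrA. Qed.
Lemma oaddC : commutative oadd.
Proof. by do 2 case=> ? ? ? ? ? ? ? ?; congr Oct; apply: addrC. Qed.
Lemma oadd0 : left_id ozero oadd.
Proof. by case=> ? ? ? ? ? ? ? ?; congr Oct; apply: add0r. Qed.
Lemma oaddN : left_inverse ozero oopp oadd.
Proof. by case=> ? ? ? ? ? ? ? ?; congr Oct; apply: addNr. Qed.

HB.instance Definition _ :=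
  GRing.isZmodule.Build (octonion A) oaddA oaddC oadd0 oaddN.

Lemma oscaleA (a b : A) x : oscale a (oscale b x) = oscale (a * b) x.
Proof. by case: x => ? ? ? ? ? ? ? ?; congr Oct; apply: mulrA. Qed.
Lemma oscale1 : left_id 1 oscale.
Proof. by case=> ? ? ? ? ? ? ? ?; congr Oct; apply: mul1r. Qed.
Lemma oscaleDr : right_distributive oscale +%R.
Proof.
by move=> c; do 2 case=> ? ? ? ? ? ? ? ?; congr Oct; apply: mulrDr.
Qed.
Lemma oscaleDl x : {morph oscale^~ x : a b / a + b}.
Proof. by case: x => ? ? ? ? ? ? ? ? a b; congr Oct; apply: mulrDl. Qed.

HB.instance Definition _ := GRing.Zmodule_isLmodule.Build A (octonion A)
  oscaleA oscale1 oscaleDr oscaleDl.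

(* Multiplication and conjugation come from three Cayley-Dickson doublings,   *)
(*   (a, b) (c, d) = (a c - d^* b, d a + b c^* ),   (a, b)^* = (a^*, - b).    *)
Definition omul x y : octonion A :=
  let: Oct a0 a1 a2 a3 a4 a5 a6 a7 := x in
  let: Oct b0 b1 b2 b3 b4 b5 b6 b7 := y in
  Oct
    (a0 * b0 - a1 * b1 - a2 * b2 - a3 * b3
       - a4 * b4 - a5 * b5 - a6 * b6 - a7 * b7)
    (a0 * b1 + a1 * b0 + a2 * b3 - a3 * b2
       + a4 * b5 - a5 * b4 - a6 * b7 + a7 * b6)
    (a0 * b2 - a1 * b3 + a2 * b0 + a3 * b1
       + a4 * b6 + a5 * b7 - a6 * b4 - a7 * b5)
    (a0 * b3 + a1 * b2 - a2 * b1 + a3 * b0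
       + a4 * b7 - a5 * b6 + a6 * b5 - a7 * b4)
    (a0 * b4 - a1 * b5 - a2 * b6 - a3 * b7
       + a4 * b0 + a5 * b1 + a6 * b2 + a7 * b3)
    (a0 * b5 + a1 * b4 - a2 * b7 + a3 * b6
       - a4 * b1 + a5 * b0 - a6 * b3 + a7 * b2)
    (a0 * b6 + a1 * b7 + a2 * b4 - a3 * b5
       - a4 * b2 + a5 * b3 + a6 * b0 - a7 * b1)
    (a0 * b7 - a1 * b6 + a2 * b5 + a3 * b4
       - a4 * b3 - a5 * b2 + a6 * b1 + a7 * b0).

Definition oconj x : octonion A :=
  let: Oct a0 a1 a2 a3 a4 a5 a6 a7 := x in
  Oct a0 (- a1) (- a2) (- a3) (- a4) (- a5) (- a6) (- a7).

Definition oscalar (a : A) : octonion A := Oct a 0 0 0 0 0 0 0.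

Definition odot x y : A := o0 (omul x (oconj y)).

Definition omulmx (n : nat) (M N : 'M[octonion A]_n) : 'M[octonion A]_n :=
  \matrix_(i, j) \sum_k omul (M i k) (N k j).

Lemma oaddE x y : x + y = oadd x y. Proof. by []. Qed.
Lemma ooppE x : - x = oopp x. Proof. by []. Qed.
Lemma oscaleE (a : A) x : a *: x = oscale a x. Proof. by []. Qed.

Lemma omul1o x : omul (oscalar 1) x = x.
Proof. by case: x => *; congr Oct; ring. Qed.

Lemma omulo1 x : omul x (oscalar 1) = x.
Proof. by case: x => *; congr Oct; ring. Qed.

Lemma omulZl (c : A) x y : omul (c *: x) y = c *: omul x y.
Proof. by case: x => *; case: y => *; congr Oct; ring. Qed.

Lemma omulZr (c : A) x y : omul x (c *: y) = c *: omul x y.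
Proof. by case: x => *; case: y => *; congr Oct; ring. Qed.

Lemma omulDl x y z : omul (x + y) z = omul x z + omul y z.
Proof. by case: x => *; case: y => *; case: z => *; congr Oct; ring. Qed.

Lemma omulDr x y z : omul x (y + z) = omul x y + omul x z.
Proof. by case: x => *; case: y => *; case: z => *; congr Oct; ring. Qed.

Lemma oconjM x y : oconj (omul x y) = omul (oconj y) (oconj x).
Proof. by case: x => *; case: y => *; congr Oct; ring. Qed.

Lemma omul_conj x : omul x (oconj x) = oscalar (odot x x).
Proof. by case: x => *; congr Oct; rewrite /odot /=; ring. Qed.

Lemma odotE x y : odot x y =
  o0 x * o0 y + o1 x * o1 y + o2 x * o2 y + o3 x * o3 y
  + o4 x * o4 y + o5 x * o5 y + o6 x * o6 y + o7 x * o7 y.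
Proof. by case: x => *; case: y => *; rewrite /odot /=; ring. Qed.

Lemma odot_mul x y : odot (omul x y) (omul x y) = odot x x * odot y y.
Proof. by rewrite !odotE; case: x => *; case: y => *; rewrite /=; ring. Qed.

End Octonions.

(* The 3 x 3 matrix h^1(xi1, xi2, xi3; x1, x2, x3) is given by its            *)
(* coordinates; the matrix itself is [jmx X], and [jmx] is injective and real *)
(* linear: see [jmxK], [jmxD] and [jmxZ].                                     *)
Record J1 (R : Type) : Type := h1 {
  xi1 : R; xi2 : R; xi3 : R;
  x1 : octonion R; x2 : octonion R; x3 : octonion R }.

Section J1Choice.
Variable R : Type.

Definition prod_of_J1 (X : J1 R) :=
  ((xi1 X, xi2 X, xi3 X), (x1 X, x2 X, x3 X)).
Definition J1_of_prod (p : R * R * R * (octonion R * octonion R * octonion R)) :=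
  let: ((a, b, c), (x, y, z)) := p in h1 a b c x y z.
Lemma prod_of_J1K : cancel prod_of_J1 J1_of_prod. Proof. by case. Qed.

End J1Choice.

HB.instance Definition _ (R : choiceType) :=
  Choice.copy (J1 R) (can_type (@prod_of_J1K R)).

Section J1Lmodule.
Variable R : comNzRingType.
Implicit Types X Y : J1 R.

Definition jzero : J1 R := h1 0 0 0 0 0 0.
Definition jopp X : J1 R :=
  h1 (- xi1 X) (- xi2 X) (- xi3 X) (- x1 X) (- x2 X) (- x3 X).
Definition jadd X Y : J1 R :=
  h1 (xi1 X + xi1 Y) (xi2 X + xi2 Y) (xi3 X + xi3 Y)
     (x1 X + x1 Y) (x2 X + x2 Y) (x3 X + x3 Y).
Definition jscale (c : R) X : J1 R :=
  h1 (c * xi1 X) (c * xi2 X) (c * xi3 X) (c *: x1 X) (c *: x2 X) (c *: x3 X).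

Lemma jaddA : associative jadd.
Proof. by move=> *; congr h1; apply: addrA. Qed.
Lemma jaddC : commutative jadd.
Proof. by move=> *; congr h1; apply: addrC. Qed.
Lemma jadd0 : left_id jzero jadd.
Proof. by case=> *; congr h1; apply: add0r. Qed.
Lemma jaddN : left_inverse jzero jopp jadd.
Proof. by case=> *; congr h1; apply: addNr. Qed.

HB.instance Definition _ :=
  GRing.isZmodule.Build (J1 R) jaddA jaddC jadd0 jaddN.

Lemma jscaleA (a b : R) X : jscale a (jscale b X) = jscale (a * b) X.
Proof. by congr h1; rewrite /= ?mulrA ?scalerA. Qed.
Lemma jscale1 : left_id 1 jscale.
Proof. by case=> *; congr h1; rewrite /= ?mul1r ?scale1r. Qed.
Lemma jscaleDr : right_distributive jscale +%R.
Proof. by move=> *; congr h1; rewrite /= ?mulrDr ?scalerDr. Qed.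
Lemma jscaleDl X : {morph jscale^~ X : a b / a + b}.
Proof. by move=> *; congr h1; rewrite /= ?mulrDl ?scalerDl. Qed.

HB.instance Definition _ := GRing.Zmodule_isLmodule.Build R (J1 R)
  jscaleA jscale1 jscaleDr jscaleDl.

End J1Lmodule.

Section JordanAlgebra.
Variable R : realType.
Implicit Types X Y : J1 R.

(* [octonion R[i]] is the complexification of [octonion R]; [ocplx x] is x    *)
(* (x) 1 and [oicplx x] is sqrt(-1) x.                                        *)
Definition ocplx (x : octonion R) : octonion R[i] := omap (fun a => a%:C) x.
Definition oicplx (x : octonion R) : octonion R[i] := 'i *: ocplx x.

Definition jentries X : seq (seq (octonion R[i])) :=
  [:: [:: ocplx (oscalar (xi1 X)); oicplx (x3 X); oicplx (oconj (x2 X))];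
      [:: oicplx (oconj (x3 X)); ocplx (oscalar (xi2 X)); ocplx (x1 X)];
      [:: oicplx (x2 X); ocplx (oconj (x1 X)); ocplx (oscalar (xi3 X))]].

Definition jmx X : 'M[octonion R[i]]_3 :=
  \matrix_(i, j) nth 0 (nth [::] (jentries X) i) j.

(* Left inverse of [jmx]. *)
Definition jcoord (M : 'M[octonion R[i]]_3) : J1 R :=
  let i1 : 'I_3 := @Ordinal 3 0 isT in
  let i2 : 'I_3 := @Ordinal 3 1 isT in
  let i3 : 'I_3 := @Ordinal 3 2 isT in
  h1 (complex.Re (o0 (M i1 i1))) (complex.Re (o0 (M i2 i2)))
     (complex.Re (o0 (M i3 i3))) (omap (@complex.Re R) (M i2 i3))
     (omap (@complex.Im R) (M i3 i1)) (omap (@complex.Im R) (M i1 i2)).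

Definition jordanmx (M N : 'M[octonion R[i]]_3) : 'M[octonion R[i]]_3 :=
  map_mx (fun v => 2^-1 *: v) (omulmx M N + omulmx N M).

(* The matrices [jmx X] are closed under [jordanmx]: see [jmx_jmul]. *)
Definition jmul X Y : J1 R := jcoord (jordanmx (jmx X) (jmx Y)).

Definition jtr X : R := xi1 X + xi2 X + xi3 X.

Definition jdot X Y : R := jtr (jmul X Y).

(* X^{x2} = X o X - tr(X) X + (tr(X)^2 - tr(X o X)) / 2 . 1: see [jsharpE]. *)
Definition jsharp X : J1 R :=
  h1 (xi2 X * xi3 X - odot (x1 X) (x1 X))
     (xi3 X * xi1 X + odot (x2 X) (x2 X))
     (xi1 X * xi2 X + odot (x3 X) (x3 X))
     (- oconj (omul (x2 X) (x3 X)) - xi1 X *: x1 X)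
     (oconj (omul (x3 X) (x1 X)) - xi2 X *: x2 X)
     (oconj (omul (x1 X) (x2 X)) - xi3 X *: x3 X).

Definition E1 : J1 R := h1 1 0 0 0 0 0.
Definition E2 : J1 R := h1 0 1 0 0 0 0.
Definition P12m : J1 R := h1 (-1) 1 0 0 0 (oscalar 1).
Definition P13m : J1 R := h1 (-1) 0 1 0 (oscalar 1) 0.

Definition F4m20 : set {linear J1 R -> J1 R} :=
  [set g : {linear J1 R -> J1 R} |
    bijective g /\ forall X Y, g (jmul X Y) = jmul (g X) (g Y)].

Definition Keps : set {linear J1 R -> J1 R} :=
  [set g : {linear J1 R -> J1 R} | F4m20 g /\ g E2 = E2].

Definition N1m : set (J1 R) :=
  [set X | [/\ jsharp X = 0, jtr X = 0 & jdot E1 X < 0]].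

(* The class of X for positive proportionality on [N1m]. *)
Definition jclass X : set (J1 R) :=
  [set Y | N1m Y /\ exists2 r : R, 0 < r & Y = r *: X].

Definition Fquot : set (set (J1 R)) := [set jclass X | X in N1m].

(* g [X] = [g X], independently of the representative: see [jact_class]. *)
Definition jact (g : {linear J1 R -> J1 R}) (c : set (J1 R)) : set (J1 R) :=
  \bigcup_(X in c) jclass (g X).

Definition Korbit (c : set (J1 R)) : set (set (J1 R)) :=
  [set jact g c | g in Keps].

Lemma omap_Re_ocplx (x : octonion R) : omap (@complex.Re R) (ocplx x) = x.
Proof. by case: x. Qed.

Lemma omap_Im_oicplx (x : octonion R) : omap (@complex.Im R) (oicplx x) = x.
Proof. by case: x => *; congr Oct; rewrite /=; ring. Qed.

Lemma jmxK : cancel jmx jcoord.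
Proof.
by case=> *; rewrite /jcoord /jmx !mxE /= omap_Re_ocplx !omap_Im_oicplx.
Qed.

Lemma omul_ocplx (x y : octonion R) :
  omul (ocplx x) (ocplx y) = ocplx (omul x y).
Proof.
by case: x => *; case: y => *; congr Oct; congr (_ +i* _); rewrite /=; ring.
Qed.

Lemma ocplxD (x y : octonion R) : ocplx (x + y) = ocplx x + ocplx y.
Proof.
by case: x => *; case: y => *; congr Oct; congr (_ +i* _); rewrite /=; ring.
Qed.

Lemma ocplxZ (c : R) (x : octonion R) : ocplx (c *: x) = c%:C *: ocplx x.
Proof. by case: x => *; congr Oct; congr (_ +i* _); rewrite /=; ring. Qed.

Lemma jmxD X Y : jmx (X + Y) = jmx X + jmx Y.
Proof.
case: X => a b c x y z; case: Y => a' b' c' x' y' z'.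
case: x => *; case: y => *; case: z => *.
case: x' => *; case: y' => *; case: z' => *.
apply/matrixP => i j; rewrite !mxE.
case: i => [[|[|[|//]]] /= _]; case: j => [[|[|[|//]]] /= _];
  congr Oct; apply/eqP; rewrite eq_complex /=; apply/andP; split; apply/eqP;
  by ring.
Qed.

Lemma jmxZ (c : R) X : jmx (c *: X) = map_mx (fun v => c%:C *: v) (jmx X).
Proof.
case: X => a b d x y z; case: x => *; case: y => *; case: z => *.
apply/matrixP => i j; rewrite !mxE.
case: i => [[|[|[|//]]] /= _]; case: j => [[|[|[|//]]] /= _];
  congr Oct; apply/eqP; rewrite eq_complex /=; apply/andP; split; apply/eqP;
  by ring.
Qed.

Definition jmul_explicit X Y : J1 R := h1
  (xi1 X * xi1 Y - odot (x2 X) (x2 Y) - odot (x3 X) (x3 Y))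
  (xi2 X * xi2 Y + odot (x1 X) (x1 Y) - odot (x3 X) (x3 Y))
  (xi3 X * xi3 Y + odot (x1 X) (x1 Y) - odot (x2 X) (x2 Y))
  (2^-1 *: ((xi2 X + xi3 X) *: x1 Y + (xi2 Y + xi3 Y) *: x1 X
     - oconj (omul (x2 X) (x3 Y) + omul (x2 Y) (x3 X))))
  (2^-1 *: ((xi3 X + xi1 X) *: x2 Y + (xi3 Y + xi1 Y) *: x2 X
     + oconj (omul (x3 X) (x1 Y) + omul (x3 Y) (x1 X))))
  (2^-1 *: ((xi1 X + xi2 X) *: x3 Y + (xi1 Y + xi2 Y) *: x3 X
     + oconj (omul (x1 X) (x2 Y) + omul (x1 Y) (x2 X)))).

Lemma sum3 (V : zmodType) (F : 'I_3 -> V) :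
  \sum_k F k =
  F (@Ordinal 3 0 isT) + F (@Ordinal 3 1 isT) + F (@Ordinal 3 2 isT).
Proof.
rewrite !big_ord_recl big_ord0 addr0 addrA.
by congr (F _ + F _ + F _); apply: val_inj.
Qed.

#[local] Arguments omul : simpl never.
#[local] Arguments oscalar : simpl never.
#[local] Arguments oconj : simpl never.
#[local] Arguments ocplx : simpl never.

Lemma jordanmxE X Y : jordanmx (jmx X) (jmx Y) = jmx (jmul_explicit X Y).
Proof.
case: X => a b c x y z; case: Y => a' b' c' x' y' z'.
apply/matrixP => i j.
have half : (2^-1 : R[i]) = (2^-1)%:C by rewrite fmorphV rmorph_nat.
have ii (u : octonion R[i]) : 'i *: ('i *: u) = (-1)%:C *: u.
  rewrite scalerA; congr (_ *: _); apply/eqP; rewrite eq_complex /=.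
  by apply/andP; split; apply/eqP; ring.
have iC (k : R[i]) (u : octonion R[i]) : k *: ('i *: u) = 'i *: (k *: u).
  by rewrite !scalerA mulrC.
rewrite /jordanmx mxE [X in _ *: X]mxE.
rewrite /omulmx ![(\matrix_(_, _) _) _ _]mxE !sum3 /jmx !mxE half.
case: x => *; case: y => *; case: z => *.
case: x' => *; case: y' => *; case: z' => *.
case: i => [[|[|[|//]]] /= _]; case: j => [[|[|[|//]]] /= _];
  rewrite /oicplx !(omulZl, omulZr) ?ii !omul_ocplx -?scalerDr -?ocplxZ
    -?ocplxD ?iC -?ocplxZ; first [congr ('i *: ocplx _) | congr (ocplx _)];
  rewrite ?odotE; congr Oct; rewrite /=; by field.
Qed.

Lemma jmulE X Y : jmul X Y = jmul_explicit X Y.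
Proof. by rewrite /jmul jordanmxE jmxK. Qed.

Lemma jmx_jmul X Y : jmx (jmul X Y) = jordanmx (jmx X) (jmx Y).
Proof. by rewrite jmulE jordanmxE. Qed.

Lemma jdotE X Y :
  jdot X Y = xi1 X * xi1 Y + xi2 X * xi2 Y + xi3 X * xi3 Y
    + 2 * odot (x1 X) (x1 Y) - 2 * odot (x2 X) (x2 Y) - 2 * odot (x3 X) (x3 Y).
Proof. by rewrite /jdot /jtr jmulE /=; ring. Qed.

Lemma jsharpE X :
  jsharp X = jmul X X - jtr X *: X
    + ((jtr X ^+ 2 - jtr (jmul X X)) / 2) *: h1 1 1 1 0 0 0.
Proof.
rewrite -[jtr (jmul X X)]/(jdot X X) jdotE jmulE /jtr.
case: X => a b c x y z /=; congr h1; rewrite /=.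
1-3: by field.
all: by case: x => *; case: y => *; case: z => *; congr Oct; rewrite /=; field.
Qed.

Lemma jclass_scale (r : R) X : 0 < r -> jclass (r *: X) = jclass X.
Proof.
move=> r0; apply/seteqP; split=> Y [NY [s s0 YE]].
- apply: (conj NY); exists (s * r); first by rewrite mulr_gt0.
  by rewrite YE scalerA.
- apply: (conj NY); exists (s / r); first by rewrite divr_gt0.
  by rewrite YE scalerA divfK // gt_eqF.
Qed.

Lemma jact_class (g : {linear J1 R -> J1 R}) X :
  N1m X -> jact g (jclass X) = jclass (g X).
Proof.
move=> NX; apply/seteqP; split=> [Y [Z [_ [r r0 ->]]]|Y NY].
- by rewrite linearZ jclass_scale.
- exists X; last exact: NY.
  by apply: (conj NX); exists 1; [exact: ltr01|rewrite scale1r].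
Qed.

End JordanAlgebra.

Arguments Fquot R : clear implicits.

(* Main.v *)
Require Import Defs.
From HB Require Import structures.
From mathcomp Require Import all_boot all_order all_algebra.
From mathcomp Require Import ring lra.
From mathcomp Require Import boolp classical_sets reals.

Set Implicit Arguments.
Unset Strict Implicit.
Unset Printing Implicit Defensive.

Import Order.TTheory GRing.Theory Num.Theory.

Local Open Scope ring_scope.
Local Open Scope classical_set_scope.

(** The trace is invariant under automorphisms because trace-zero elements are
  sums of associators; hence so are the form and [jsharp], and [xi2 X = (X|E_2)]
  is constant on orbits of the stabilizer of [E_2].  Conversely, the stabilizer
  contains the twists (unit octonions acting through the Moufang identities) and
  the boosts mixing the indices 1 and 3.  If [xi2 X = 0] then [X] is a positive
  multiple of a twist of [P13m].  If [xi2 X = 1], a twist makes [x2 X] real and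
  nonnegative, a boost then kills [x1 X], which forces [X] to be a twist of
  [P12m]. *)

(** * Octonion identities: conjugation, norm, alternativity, Moufang *)

Section OctonionIdentities.
Variable A : comNzRingType.
Implicit Types u x y z : octonion A.

Lemma odotC x y : odot x y = odot y x.
Proof. by rewrite !odotE; ring. Qed.

Lemma odotZl (k : A) x y : odot (k *: x) y = k * odot x y.
Proof. by rewrite !odotE; case: x => *; rewrite /=; ring. Qed.

Lemma odotZr (k : A) x y : odot x (k *: y) = k * odot x y.
Proof. by rewrite odotC odotZl odotC. Qed.

Lemma odot_conj x y : odot (oconj x) (oconj y) = odot x y.
Proof. by rewrite !odotE; case: x => *; case: y => *; rewrite /=; ring. Qed.

Lemma oconjK : involutive (@oconj A).
Proof. by case=> *; congr Oct; rewrite /= ?opprK. Qed.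

Lemma oconjD x y : oconj (x + y) = oconj x + oconj y.
Proof. by case: x => *; case: y => *; congr Oct; rewrite /=; ring. Qed.

Lemma omulNl x y : omul (- x) y = - omul x y.
Proof. by rewrite -scaleN1r omulZl scaleN1r. Qed.

Lemma omulNr x y : omul x (- y) = - omul x y.
Proof. by rewrite -scaleN1r omulZr scaleN1r. Qed.

Lemma odot_mull u x y : odot (omul u x) (omul u y) = odot u u * odot x y.
Proof.
by rewrite !odotE; case: u => *; case: x => *; case: y => *; rewrite /=; ring.
Qed.

Lemma odot_mulr u x y : odot (omul x u) (omul y u) = odot u u * odot x y.
Proof.
by rewrite !odotE; case: u => *; case: x => *; case: y => *; rewrite /=; ring.
Qed.

Lemma odot0l x : odot 0 x = 0.
Proof. by rewrite -(scale0r x) odotZl mul0r. Qed.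

Lemma odot0r x : odot x 0 = 0.
Proof. by rewrite odotC odot0l. Qed.

Lemma omul0l x : omul 0 x = 0.
Proof. by rewrite -(scale0r x) omulZl !scale0r. Qed.

Lemma omul0r x : omul x 0 = 0.
Proof. by rewrite -(scale0r x) omulZr !scale0r. Qed.

Lemma oconj0 : oconj 0 = 0 :> octonion A.
Proof. by congr Oct; rewrite oppr0. Qed.

Lemma omul_conjl x : omul (oconj x) x = oscalar (odot x x).
Proof. by rewrite -{2}[x]oconjK omul_conj odot_conj. Qed.

Lemma odot_adjr x y z : odot x (omul y z) = odot (omul x (oconj z)) y.
Proof.
by rewrite !odotE; case: x => *; case: y => *; case: z => *; rewrite /=; ring.
Qed.

Lemma odotBB x y :
  odot (x - y) (x - y) = odot x x - 2 * odot x y + odot y y.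
Proof. by rewrite !odotE; case: x => *; case: y => *; rewrite /=; ring. Qed.

(** Alternativity: [oconj x] differs from [- x] by a real scalar, so the cancellations below hold
    although octonions do not associate. *)
Lemma omulKl x y : omul (oconj x) (omul x y) = odot x x *: y.
Proof.
by rewrite odotE; case: x => *; case: y => *; congr Oct; rewrite /=; ring.
Qed.

Lemma omulKr x y : omul (omul y x) (oconj x) = odot x x *: y.
Proof.
by rewrite odotE; case: x => *; case: y => *; congr Oct; rewrite /=; ring.
Qed.

Lemma omulVKl x y : omul x (omul (oconj x) y) = odot x x *: y.
Proof. by rewrite -{1}[x]oconjK omulKl odot_conj. Qed.

Lemma omulVKr x y : omul (omul y (oconj x)) x = odot x x *: y.
Proof. by rewrite -{2}[x]oconjK omulKr odot_conj. Qed.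

Lemma omul_flex x y : omul (omul x y) x = omul x (omul y x).
Proof. by case: x => *; case: y => *; congr Oct; ring. Qed.

(** The three Moufang identities each control one of the cyclic products that occur in
    [twist_jmul]. *)
Lemma moufang_middle u x y :
  omul (omul u x) (omul y u) = omul (omul u (omul x y)) u.
Proof. by case: u => *; case: x => *; case: y => *; congr Oct; ring. Qed.

Lemma moufang_left u x y :
  omul u (omul x (omul u y)) = omul (omul (omul u x) u) y.
Proof. by case: u => *; case: x => *; case: y => *; congr Oct; ring. Qed.

Lemma moufang_right u x y :
  omul (omul (omul x u) y) u = omul x (omul (omul u y) u).
Proof. by case: u => *; case: x => *; case: y => *; congr Oct; ring. Qed.

End OctonionIdentities.

(** * Positivity of the octonion norm *)

Section OctonionNorm.
Variable R : realType.
Implicit Types x y s : octonion R.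

Lemma odot_ge0 x : 0 <= odot x x.
Proof. by rewrite odotE -!expr2 !addr_ge0 ?sqr_ge0. Qed.

Lemma odot_eq0 x : odot x x = 0 -> x = 0.
Proof.
rewrite odotE -!expr2; case: x => a0 a1 a2 a3 a4 a5 a6 a7 /= /eqP.
rewrite !paddr_eq0 ?addr_ge0 ?sqr_ge0 // !sqrf_eq0.
by do 7 case/andP; do 8 move/eqP->.
Qed.

(** For [p > 0], expand the squared norm of [p *: x - omul s (oconj y)], which is nonnegative, and
    divide by [p]. For [p = 0] the hypothesis on [s] forces [s = 0]. *)
Lemma odot_young x y s (p q : R) : 0 <= p -> 0 <= q ->
  odot s s = p * q -> 2 * odot s (omul x y) <= p * odot x x + q * odot y y.
Proof.
rewrite le_eqVlt => /predU1P[<-|p0] q0 ss.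
  have -> : s = 0 by apply: odot_eq0; rewrite ss mul0r.
  rewrite -(scale0r (omul x y)) odotZl !(mul0r, mulr0) add0r.
  by rewrite mulr_ge0 ?odot_ge0.
have := odot_ge0 (p *: x - omul s (oconj y)).
rewrite odotBB odotZl odotZr odotZl odot_mulr odot_conj ss.
rewrite (odotC x) -odot_adjr => h.
rewrite -(ler_pM2l p0) -subr_ge0; apply: le_trans h _.
by rewrite le_eqVlt; apply/orP; left; apply/eqP; ring.
Qed.

End OctonionNorm.

(** * Two families of automorphisms fixing [E2] *)

Section Generators.
Variable R : realType.
Implicit Types (X Y Z : J1 R) (u v : octonion R) (C S : R).

(** For a unit [u] the three off-diagonal maps form a triality triple, compatible with the cyclic
    products [oconj (omul x2 x3)], [oconj (omul x3 x1)] and [oconj (omul x1 x2)]. *)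
Definition twist u X : J1 R := h1 (xi1 X) (xi2 X) (xi3 X)
  (omul (omul (oconj u) (x1 X)) (oconj u)) (omul u (x2 X)) (omul (x3 X) u).

Lemma twist_is_linear u : linear (twist u).
Proof.
by move=> k X Y; congr h1; rewrite /= ?(omulDr, omulDl, omulZl, omulZr).
Qed.
HB.instance Definition _ u :=
  GRing.isLinear.Build R (J1 R) (J1 R) *:%R (twist u) (twist_is_linear u).

Lemma twistK u : odot u u = 1 -> cancel (twist u) (twist (oconj u)).
Proof.
move=> u1 [a b c x y z].
congr h1; rewrite /= ?oconjK.
- by rewrite omul_flex omulVKr u1 scale1r omulVKl u1 scale1r.
- by rewrite omulKl u1 scale1r.
- by rewrite omulKr u1 scale1r.
Qed.

Lemma twist_jmul u X Y : odot u u = 1 ->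
  twist u (jmul X Y) = jmul (twist u X) (twist u Y).
Proof.
move=> u1; have u1' : odot (oconj u) (oconj u) = 1 by rewrite odot_conj.
have mul23 y z : oconj (omul (omul u y) (omul z u))
    = omul (omul (oconj u) (oconj (omul y z))) (oconj u).
  rewrite moufang_middle !oconjM.
  by case: u {u1 u1'} => *; case: y => *; case: z => *; congr Oct; ring.
have mul31 z x : oconj (omul (omul z u) (omul (omul (oconj u) x) (oconj u)))
    = omul u (oconj (omul z x)).
  by rewrite -moufang_right omulKr u1 scale1r oconjM oconjK.
have mul12 x y : oconj (omul (omul (omul (oconj u) x) (oconj u)) (omul u y))
    = omul (oconj (omul x y)) u.
  by rewrite -moufang_left omulKl u1 scale1r oconjM oconjK.
rewrite !jmulE; congr h1; rewrite /= ?odot_mull ?odot_mulr ?odot_mull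
  ?u1 ?u1' ?mul1r //.
- by rewrite !(omulDr, omulDl, oconjD, omulZl, omulZr, omulNl, omulNr, mul23).
- by rewrite !(omulDr, omulDl, oconjD, omulZl, omulZr, mul31).
- by rewrite !(omulDr, omulDl, oconjD, omulZl, omulZr, mul12).
Qed.

(** This is [g X g^T] for the matrix [g] with rows [(C, 0, iS)], [(0, 1, 0)], [(-iS, 0, C)], where
    [i] is the complex unit. It is complex orthogonal when [C ^+ 2 = 1 + S ^+ 2]: a rotation of
    indices 1 and 3 by an imaginary angle. *)
Definition boost C S X : J1 R := h1
  (C ^+ 2 * xi1 X - S ^+ 2 * xi3 X - 2 * S * C * o0 (x2 X))
  (xi2 X)
  (C ^+ 2 * xi3 X - S ^+ 2 * xi1 X + 2 * S * C * o0 (x2 X))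
  (C *: x1 X + S *: oconj (x3 X))
  (C ^+ 2 *: x2 X + S ^+ 2 *: oconj (x2 X) + oscalar (S * C * (xi3 X - xi1 X)))
  (C *: x3 X + S *: oconj (x1 X)).

Lemma boost_is_linear C S : linear (boost C S).
Proof.
move=> k [a b c x y z] [a' b' c' x' y' z']; congr h1; rewrite /=.
1-2: by case: y => *; case: y' => *; rewrite ?(oaddE, ooppE, oscaleE) /=; ring.
- by case: x => *; case: x' => *; case: z => *; case: z' => *;
  congr Oct; rewrite ?(oaddE, ooppE, oscaleE) /=; ring.
- by case: y => *; case: y' => *; congr Oct;
  rewrite ?(oaddE, ooppE, oscaleE) /=; ring.
- by case: x => *; case: x' => *; case: z => *; case: z' => *;
  congr Oct; rewrite ?(oaddE, ooppE, oscaleE) /=; ring.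
Qed.
HB.instance Definition _ C S :=
  GRing.isLinear.Build R (J1 R) (J1 R) *:%R (boost C S) (boost_is_linear C S).

Lemma boostK C S : C ^+ 2 = 1 + S ^+ 2 -> cancel (boost C S) (boost C (- S)).
Proof.
move=> CS [a b c x y z]; congr h1; rewrite /=.
1-2: by case: y => *; rewrite ?(oaddE, ooppE, oscaleE) /=; ring: CS.
- by case: x => *; case: z => *; congr Oct;
  rewrite ?(oaddE, ooppE, oscaleE) /=; ring: CS.
- by case: y => *; congr Oct; rewrite ?(oaddE, ooppE, oscaleE) /=; ring: CS.
- by case: x => *; case: z => *; congr Oct;
  rewrite ?(oaddE, ooppE, oscaleE) /=; ring: CS.
Qed.

Lemma boost_jmul C S X Y : C ^+ 2 = 1 + S ^+ 2 ->
  boost C S (jmul X Y) = jmul (boost C S X) (boost C S Y).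
Proof.
rewrite !jmulE; case: X => a b c x y z; case: Y => a' b' c' x' y' z' CS.
congr h1; rewrite /= ?odotE.
1-3: case: x => *; case: x' => *; case: y => *; case: y' => *;
  case: z => *; case: z' => *; rewrite ?(oaddE, ooppE, oscaleE) /=.
1-3: by field: CS.
all: case: x => *; case: x' => *; case: y => *; case: y' => *;
  case: z => *; case: z' => *; congr Oct; rewrite /=.
all: by field: CS.
Qed.

End Generators.

(** * Invariance of trace, form and [jsharp] under automorphisms *)

Section Invariance.
Variable R : realType.
Implicit Types (X Y Z : J1 R) (g : {linear J1 R -> J1 R}).

Definition jone : J1 R := h1 1 1 1 0 0 0.
Definition jF1 (x : octonion R) : J1 R := h1 0 0 0 x 0 0.
Definition jF2 (x : octonion R) : J1 R := h1 0 0 0 0 x 0.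
Definition jF3 (x : octonion R) : J1 R := h1 0 0 0 0 0 x.
Definition E3 : J1 R := h1 0 0 1 0 0 0.

Definition jassoc X Y Z := jmul (jmul X Y) Z - jmul X (jmul Y Z).

Lemma jmul1 X : jmul jone X = X.
Proof.
rewrite jmulE; case: X => a b c x y z; congr h1; rewrite ?odotE /=.
1-3: by field.
all: case: x => *; case: y => *; case: z => *; congr Oct; rewrite /=; by field.
Qed.

Lemma jmulC X Y : jmul X Y = jmul Y X.
Proof.
rewrite !jmulE; case: X => a b c x y z; case: Y => a' b' c' x' y' z'.
congr h1; rewrite ?odotE /=; try by ring.
1-3: congr (_ *: (_ + _)); first exact: addrC.
1-3: congr (- oconj _) || congr oconj; exact: addrC.
Qed.

(** Equivalent to the associativity of the trace form, checked in coordinates. *)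
Lemma jtr_assoc X Y Z : jtr (jassoc X Y Z) = 0.
Proof.
have -> : jtr (jassoc X Y Z) = jdot (jmul X Y) Z - jdot X (jmul Y Z).
  by rewrite /jdot /jtr /jassoc /=; ring.
rewrite !jdotE !jmulE; case: X => a b c x y z; case: Y => a' b' c' x' y' z'.
case: Z => a'' b'' c'' x'' y'' z''; rewrite /= !odotE.
case: x => *; case: x' => *; case: x'' => *.
case: y => *; case: y' => *; case: y'' => *.
case: z => *; case: z' => *; case: z'' => *.
by rewrite ?(oaddE, ooppE, oscaleE) /=; field.
Qed.

Lemma jmul_E1 X : jmul (E1 R) X =
  h1 (xi1 X) 0 0 0 (2^-1 *: x2 X) (2^-1 *: x3 X).
Proof.
rewrite jmulE; case: X => a b c x y z; congr h1; rewrite ?odotE /=.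
1-3: by ring.
all: case: x => *; case: y => *; case: z => *; congr Oct; rewrite /=; by ring.
Qed.

Lemma jmul_E1E1 : jmul (E1 R) (E1 R) = E1 R.
Proof. by rewrite jmul_E1 /= !scaler0. Qed.

Lemma jmul_E2 X : jmul (E2 R) X =
  h1 0 (xi2 X) 0 (2^-1 *: x1 X) 0 (2^-1 *: x3 X).
Proof.
rewrite jmulE; case: X => a b c x y z; congr h1; rewrite ?odotE /=.
1-3: by ring.
all: case: x => *; case: y => *; case: z => *; congr Oct; rewrite /=; by ring.
Qed.

Lemma jmul_E2E2 : jmul (E2 R) (E2 R) = E2 R.
Proof. by rewrite jmul_E2 /= !scaler0. Qed.

Lemma jmul_F1 (x y : octonion R) : jmul (jF1 x) (jF1 y) =
  odot x y *: (E2 R + E3).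
Proof.
rewrite jmulE odotE; case: x => *; case: y => *; congr h1; rewrite ?odotE /=.
1-3: by ring.
all: congr Oct; rewrite /=; by ring.
Qed.

Lemma jmul_F2 (x y : octonion R) : jmul (jF2 x) (jF2 y) =
  - odot x y *: (E3 + E1 R).
Proof.
rewrite jmulE odotE; case: x => *; case: y => *; congr h1; rewrite ?odotE /=.
1-3: by ring.
all: congr Oct; rewrite /=; by ring.
Qed.

(** On the 1/2-eigenspace of an idempotent [e], the associator with [e], [e] acts as 1/2 - 1/4. The
    same applies to the next two lemmas. *)
Lemma jassoc_E2_F1 x : jassoc (E2 R) (E2 R) (jF1 x) = 4^-1 *: jF1 x.
Proof.
rewrite /jassoc jmul_E2E2 !jmul_E2; congr h1; rewrite /=; try by ring.
all: rewrite ?(scaler0, subr0) // !scalerA -scalerBl; congr (_ *: _); by field.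
Qed.

Lemma jassoc_E1_F2 x : jassoc (E1 R) (E1 R) (jF2 x) = 4^-1 *: jF2 x.
Proof.
rewrite /jassoc jmul_E1E1 !jmul_E1; congr h1; rewrite /=; try by ring.
all: rewrite ?(scaler0, subr0) // !scalerA -scalerBl; congr (_ *: _); by field.
Qed.

Lemma jassoc_E1_F3 x : jassoc (E1 R) (E1 R) (jF3 x) = 4^-1 *: jF3 x.
Proof.
rewrite /jassoc jmul_E1E1 !jmul_E1; congr h1; rewrite /=; try by ring.
all: rewrite ?(scaler0, subr0) // !scalerA -scalerBl; congr (_ *: _); by field.
Qed.

Lemma odot1Z (k : R) : odot (oscalar 1) (k *: oscalar 1) = k.
Proof. by rewrite odotZr odotE /=; ring. Qed.

Lemma jassoc_F1_E2 :
  jassoc (jF1 (oscalar 1)) (jF1 (oscalar 1)) (E2 R) = 2^-1 *: (E2 R - E3).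
Proof.
rewrite /jassoc (jmulC (jF1 _) (E2 R)) jmul_E2 /= scaler0 !jmul_F1 odot1Z.
rewrite -[oscalar 1 in X in odot _ X]scale1r odot1Z scale1r jmulC jmul_E2.
congr h1; rewrite /= ?(scaler0, addr0, subr0) //; by field.
Qed.

Lemma jassoc_F2_E1 :
  jassoc (jF2 (oscalar 1)) (jF2 (oscalar 1)) (E1 R) = 2^-1 *: (E3 - E1 R).
Proof.
rewrite /jassoc (jmulC (jF2 _) (E1 R)) jmul_E1 /= scaler0 !jmul_F2 odot1Z.
rewrite -[oscalar 1 in X in odot _ X]scale1r odot1Z jmulC jmul_E1.
congr h1; rewrite /= ?(scaler0, addr0, subr0, oppr0) //; by field.
Qed.

(* Trace-zero elements are sums of associators. *)
Lemma trace0_ind (P : J1 R -> Prop) X :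
  (forall U V, P U -> P V -> P (U + V)) ->
  (forall k U V W, P (k *: jassoc U V W)) ->
  P (X - (jtr X / 3) *: jone).
Proof.
(* The first three terms give the off-diagonal part. The last two give the diagonal, since [E2 - E3]
   and [E3 - E1] span the trace-zero diagonal elements; the factors 4 and 2 cancel the scalars of
   the associators. *)
move=> PD PA; have -> : X - (jtr X / 3) *: jone =
    4 *: jassoc (E2 R) (E2 R) (jF1 (x1 X))
    + (4 *: jassoc (E1 R) (E1 R) (jF2 (x2 X))
    + (4 *: jassoc (E1 R) (E1 R) (jF3 (x3 X))
    + ((2 * (xi2 X - jtr X / 3)) *:
         jassoc (jF1 (oscalar 1)) (jF1 (oscalar 1)) (E2 R)
    + (- (2 * (xi1 X - jtr X / 3))) *:
         jassoc (jF2 (oscalar 1)) (jF2 (oscalar 1)) (E1 R)))).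
  rewrite jassoc_E2_F1 jassoc_E1_F2 jassoc_E1_F3 jassoc_F1_E2 jassoc_F2_E1.
  have fq : 4 * 4^-1 = 1 :> R by field.
  rewrite !scalerA !fq !scale1r /jtr; case: X => a b c x y z.
  congr h1; rewrite /=.
  1-3: by field.
  1-3: by rewrite ?(scaler0, subrr, oppr0, addr0, add0r).
by do 4?[apply: (PD); first exact: PA]; exact: PA.
Qed.

Lemma F4_one g : F4m20 g -> g jone = jone.
Proof.
case=> -[h hK gK] gM.
by rewrite -[LHS]jmul1 jmulC -[X in jmul _ X]gK -gM jmul1 gK.
Qed.

Lemma F4_assoc g X Y Z : F4m20 g ->
  g (jassoc X Y Z) = jassoc (g X) (g Y) (g Z).
Proof. by case=> _ gM; rewrite /jassoc raddfB /= !gM. Qed.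

Lemma jtrD X Y : jtr (X + Y) = jtr X + jtr Y.
Proof. by rewrite /jtr /=; ring. Qed.

Lemma jtrZ (k : R) X : jtr (k *: X) = k * jtr X.
Proof. by rewrite /jtr /=; ring. Qed.

Lemma F4_tr g X : F4m20 g -> jtr (g X) = jtr X.
Proof.
move=> gF; have : jtr (g (X - (jtr X / 3) *: jone)) = 0.
  apply: (trace0_ind (P := fun U => jtr (g U) = 0)) => [U V U0 V0|k U V W].
    by rewrite linearD jtrD U0 V0 addr0.
  by rewrite linearZ /= F4_assoc // jtrZ jtr_assoc mulr0.
rewrite linearB linearZ /= F4_one // -scaleNr jtrD jtrZ => /eqP.
rewrite mulNr subr_eq0 => /eqP ->; rewrite [jtr jone]/jtr /=; by field.
Qed.

Lemma F4_dot g X Y : F4m20 g -> jdot (g X) (g Y) = jdot X Y.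
Proof. by move=> gF; rewrite /jdot -gF.2 F4_tr. Qed.

Lemma F4_sharp g X : F4m20 g -> jsharp (g X) = g (jsharp X).
Proof.
move=> gF; rewrite !jsharpE -/jone linearD linearB !linearZ /= -!gF.2.
by rewrite F4_one // !F4_tr.
Qed.

Lemma jdot_E1 X : jdot (E1 R) X = xi1 X.
Proof. by rewrite jdotE /= !odotE /=; ring. Qed.

Lemma jdot_E2 X : jdot X (E2 R) = xi2 X.
Proof. by rewrite jdotE /= !odotE /=; ring. Qed.

Lemma Keps_xi2 g X : Keps g -> xi2 (g X) = xi2 X.
Proof. by move=> [gF g2]; rewrite -!jdot_E2 -{1}g2 F4_dot. Qed.

Lemma N1mP X : N1m X ->
  [/\ xi1 X = - (xi2 X + xi3 X), 0 < xi2 X + xi3 X,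
      0 <= xi2 X /\ 0 <= xi3 X
    & [/\ odot (x1 X) (x1 X) = xi2 X * xi3 X,
          odot (x2 X) (x2 X) = xi3 X * (xi2 X + xi3 X)
        & odot (x3 X) (x3 X) = xi2 X * (xi2 X + xi3 X)]].
Proof.
case=> s0 t0; rewrite jdot_E1 => a0.
have := congr1 (@xi1 R) s0; have := congr1 (@xi2 R) s0.
have := congr1 (@xi3 R) s0; rewrite /= => e3 e2 e1.
have aE : xi1 X = - (xi2 X + xi3 X) by move: t0; rewrite /jtr; lra.
have p2 := odot_ge0 (x2 X); have p3 := odot_ge0 (x3 X).
rewrite aE in e1 e2 e3 a0.
(* The products of [xi2 X] and [xi3 X] with the positive number [xi2 X + xi3 X] are squared norms,
   so both are nonnegative. *)
split; [by []|lra|split; nra|split; lra].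
Qed.

End Invariance.

(** * Stability of the null cone [N1m] under [Keps] *)

Section NullCone.
Variable R : realType.
Implicit Types (X Y Z : J1 R) (g : {linear J1 R -> J1 R}) (u : octonion R).

Lemma half_E2P Z : jmul (E2 R) Z = 2^-1 *: Z ->
  [/\ xi1 Z = 0, xi2 Z = 0, xi3 Z = 0 & x2 Z = 0].
Proof.
rewrite jmul_E2 => e.
have := congr1 (@xi1 R) e; have := congr1 (@xi2 R) e.
have := congr1 (@xi3 R) e; have := congr1 (@x2 R) e; rewrite /=.
move=> e2 c b a; split; [lra|lra|lra|].
have : (2 : R) *: (2^-1 *: x2 Z) = 0 by rewrite -e2 scaler0.
by rewrite scalerA divff ?scale1r // pnatr_eq0.
Qed.

(** Only [u = x1 Z] and [v = x3 Z] survive, and with [b = xi2 X], [c = xi3 X] the form equals [c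
    |v|^2 + (b + c) |u|^2 - 2 (oconj (x2 X) | v u)]. As [|x2 X|^2 = c (b + c)], [odot_young]
    applies. *)
Lemma N1m_half_ge0 X Z : N1m X -> jmul (E2 R) Z = 2^-1 *: Z ->
  0 <= jdot X (jmul Z Z).
Proof.
move=> /N1mP[aE bc0 [b0 c0] [_ yy _]] /half_E2P.
rewrite jdotE jmulE; case: Z => p q r u w v /= [-> -> -> ->].
rewrite !(addr0, scale0r, mulr0, sub0r, subr0, add0r).
rewrite !(omul0l, omul0r, odot0l, odot0r).
have hE : odot (x2 X) (2^-1 *: oconj (omul v u + omul v u))
   = odot (oconj (x2 X)) (omul v u).
  rewrite odotE [RHS]odotE; case: (x2 X) => *.
  by case: (omul v u) => *; rewrite /=; field.
have := @odot_young R v u (oconj (x2 X)) (xi3 X) (xi2 X + xi3 X) c0 (ltW bc0).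
rewrite odot_conj yy => /(_ erefl).
rewrite hE aE !addr0 oconj0 !oppr0 !scaler0 !odot0r => h.
by lra.
Qed.

(* [xi1 (g X) <= 0] because [E2 + E3 = (jF1 1) ^ 2] is the image of the square
   of an element of the 1/2-eigenspace of [E2]. *)
Lemma Keps_N1m g X : Keps g -> N1m X -> N1m (g X).
Proof.
move=> gK NX; have [gF g2] := gK; have [s0 t0 _] := NX.
have sg : jsharp (g X) = 0 by rewrite F4_sharp // s0 linear0.
have tg : jtr (g X) = 0 by rewrite F4_tr.
split=> //; rewrite jdot_E1.
have [[h hK gK'] gM] := gF.
set Z := h (jF1 (oscalar 1)).
have gZ : g Z = jF1 (oscalar 1) by rewrite gK'.
have Z2 : jmul (E2 R) Z = 2^-1 *: Z.
  apply: (can_inj hK); rewrite gM linearZ /= g2 gZ jmul_E2.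
  by congr h1; rewrite /= ?mulr0 ?scaler0.
have := N1m_half_ge0 NX Z2.
rewrite -(F4_dot X (jmul Z Z) gF) gM gZ jmul_F1.
have -> : odot (oscalar 1) (oscalar 1) = 1 :> R by rewrite odotE /=; ring.
rewrite scale1r jdotE /= !addr0 !odot0r => bc.
have a0 : xi1 (g X) <= 0 by move: tg; rewrite /jtr; lra.
(* Strictness: if [xi1 (g X) = 0], then [xi3 = - xi2], and the diagonal equations of
   [jsharp (g X) = 0] force every coordinate to vanish, so [X = 0], against [xi1 X < 0]. *)
rewrite lt_neqAle a0 andbT; apply/eqP => a0'.
have := congr1 (@xi1 R) sg; have := congr1 (@xi2 R) sg.
have := congr1 (@xi3 R) sg; rewrite /= a0' => e3 e2 e1.
have p1 := odot_ge0 (x1 (g X)); have p2 := odot_ge0 (x2 (g X)).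
have p3 := odot_ge0 (x3 (g X)).
have cb : xi3 (g X) = - xi2 (g X) by move: tg; rewrite /jtr a0'; lra.
have b0 : xi2 (g X) = 0.
  by apply/eqP; rewrite -sqrf_eq0 eq_le sqr_ge0 andbT; rewrite cb in e1; nra.
rewrite cb b0 in e1 e2 e3.
have gX0 : g X = 0.
  case: (g X) a0' b0 cb e1 e2 e3 {sg tg a0 bc p1 p2 p3} => a b c x y z /=.
  move=> -> -> -> e1 e2 e3; congr h1; rewrite ?oppr0 //; apply: odot_eq0; lra.
have X0 : X = 0 by apply: (can_inj hK); rewrite gX0 linear0.
by case: NX => _ _; rewrite jdot_E1 X0 ltxx.
Qed.

End NullCone.

(** * Moving null vectors to [P12m] or [P13m] *)

Section Transitivity.
Variable R : realType.
Implicit Types (X Y P : J1 R) (g h : {linear J1 R -> J1 R}) (u : octonion R).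
#[local] Arguments omul : simpl never.
#[local] Arguments oconj : simpl never.

Lemma Keps_comp g h : Keps g -> Keps h -> Keps (g \o h).
Proof.
move=> [[gb gM] g2] [[hb hM] h2]; split; last by rewrite /= h2.
by split=> [|X Y]; [exact: bij_comp|rewrite /= hM gM].
Qed.

Lemma Keps_twist u : odot u u = 1 -> Keps (twist u).
Proof.
move=> u1; split; last first.
  by congr h1; rewrite /= ?(omul0l, omul0r).
split=> [|X Y]; last exact: twist_jmul.
exists (twist (oconj u)); first exact: twistK.
by rewrite -{2}[u]oconjK; apply: twistK; rewrite odot_conj.
Qed.

Lemma Keps_boost (C S : R) : C ^+ 2 = 1 + S ^+ 2 -> Keps (boost C S).
Proof.
move=> CS; split; last first.
  congr h1; rewrite /= ?oconj0 ?scaler0 ?addr0 //; try by ring.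
  by congr Oct; rewrite /=; ring.
split=> [|X Y]; last exact: boost_jmul.
exists (boost C (- S)); first exact: boostK.
by rewrite -{2}[S]opprK; apply: boostK; rewrite sqrrN.
Qed.

(** Membership of the class of [X] in the orbit of the class of [P], phrased on representatives;
    [KorbitE] returns to classes. *)
Definition reach P X := exists2 g, Keps g & exists2 r : R, 0 < r & X = r *: g P.

Lemma reach_act P X g : Keps g -> reach P X -> reach P (g X).
Proof.
move=> gK [h hK [r r0 ->]]; exists (g \o h); first exact: Keps_comp.
by exists r => //; rewrite linearZ.
Qed.

Lemma reach_scale P X (s : R) : 0 < s -> reach P X -> reach P (s *: X).
Proof.
move=> s0 [g gK [r r0 ->]]; exists g => //.
exists (s * r); first exact: mulr_gt0.
by rewrite scalerA.
Qed.

Lemma N1m_scale X (s : R) : 0 < s -> N1m X -> N1m (s *: X).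
Proof.
move=> s0 [sX tX aX]; split; last by move: aX; rewrite !jdot_E1 /= pmulr_rlt0.
  have -> : jsharp (s *: X) = s ^+ 2 *: jsharp X; last by rewrite sX scaler0.
  case: X {sX tX aX} => a b c x y z; congr h1; rewrite /= ?odotZl ?odotZr.
  1-3: by ring.
  1-3: by case: x => *; case: y => *; case: z => *; congr Oct; rewrite /=; ring.
by rewrite jtrZ tX mulr0.
Qed.

(** By [N1mP], [x1 X] and [x3 X] vanish and [x2 X] has norm [xi3 X]. The twist by the unit octonion
    [x2 X / xi3 X] sends the entry 1 of [P13m] to that unit. *)
Lemma reach_P13 X : N1m X -> xi2 X = 0 -> reach (P13m R) X.
Proof.
move=> /N1mP[aE bc0 _ [xx yy zz]] b0; move: aE bc0 xx yy zz; rewrite b0.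
rewrite !(add0r, mul0r) => aE c0 /odot_eq0 xx yy /odot_eq0 zz.
exists (twist ((xi3 X)^-1 *: x2 X)).
  apply: Keps_twist; rewrite odotZl odotZr yy; field; exact: lt0r_neq0.
exists (xi3 X) => //.
case: X aE b0 c0 xx yy zz => a b c x y z /= -> -> c0 -> _ ->.
congr h1; rewrite /= ?(omul0l, omul0r, scaler0) //; try by ring.
by rewrite omulo1 scalerA divff ?scale1r // lt0r_neq0.
Qed.

(** Here [xi3 X = |x1 X|^2 = 0], so [x2 X = 0] and [x3 X] is a unit octonion, the image of 1 under
    its own twist. *)
Lemma reach_P12_x1 X : N1m X -> xi2 X = 1 -> x1 X = 0 -> reach (P12m R) X.
Proof.
move=> /N1mP[aE _ _ [xx yy zz]] b1 x0; move: aE xx yy zz; rewrite b1 x0.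
rewrite !mul1r odot0l => aE c0; rewrite -c0 mul0r addr0 => /odot_eq0 yy zz.
exists (twist (x3 X)); first exact: Keps_twist.
exists 1 => //; rewrite scale1r.
case: X aE b1 x0 c0 yy zz => a b c x y z /= -> -> -> <- -> _.
congr h1; rewrite /= ?(omul0l, omul0r) ?omul1o //; by ring.
Qed.

(* The boost parameters are [cosh] and [sinh] of the rapidity that brings the
   [x1]-coordinate to zero. *)
Lemma reach_P12_real X (t : R) : N1m X -> xi2 X = 1 -> x2 X = oscalar t ->
  0 <= t -> reach (P12m R) X.
Proof.
move=> NX b1 yt t0; have [sX _ _] := NX.
have [aE _ [_ c0]] := N1mP NX.
rewrite b1 yt !mul1r => -[xx yy zz].
(* The [x2]-coordinate of [jsharp X = 0] says that [omul (x3 X) (x1 X)] is the real number [t]. *)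
have := congr1 (@x2 R) sX; rewrite /= b1 yt scale1r => /eqP.
rewrite subr_eq0 => /eqP /(congr1 (@oconj R)); rewrite oconjK => zx.
have {}zx : omul (x3 X) (x1 X) = oscalar t.
  by rewrite zx; congr Oct; rewrite oppr0.
set c := xi3 X in c0 aE xx yy zz.
(* These are the norm of [x3 X] and minus the norm of [x1 X]; the sign gives [t = - S * C]. *)
set C := Num.sqrt (1 + c); set S := - Num.sqrt c.
have c1 : 0 < 1 + c by lra.
have C0 : 0 < C by rewrite sqrtr_gt0.
have CC : C ^+ 2 = 1 + c by rewrite sqr_sqrtr // ltW.
have SS : S ^+ 2 = c by rewrite sqrrN sqr_sqrtr.
have CS : C ^+ 2 = 1 + S ^+ 2 by rewrite CC SS.
have tE : t = - S * C.
  have tt : t ^+ 2 = c * (1 + c) by rewrite -yy odotE /=; ring.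
  by rewrite opprK -sqrtrM // -tt sqrtr_sqr ger0_norm.
have x1E : C *: x1 X + S *: oconj (x3 X) = 0.
  (* Since [C ^+ 2 = |x3 X|^2], the first term is [omul (oconj (x3 X)) (omul (x3 X) (x1 X))], that
     is [t *: oconj (x3 X)], which cancels the second. *)
  have : C *: (C *: x1 X + S *: oconj (x3 X)) = 0.
    rewrite scalerDr !scalerA -expr2 CC -zz -omulKl zx tE.
    by case: (x3 X) => *; congr Oct; ring.
  move/(congr1 (fun v => C^-1 *: v)).
  by rewrite scalerA mulVf ?lt0r_neq0 // scale1r scaler0.
rewrite -(boostK CS X); apply: reach_act.
  by apply: Keps_boost; rewrite sqrrN.
by apply: reach_P12_x1; rewrite ?b1 //; apply: Keps_N1m => //;
  exact: Keps_boost.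
Qed.

Lemma reach_P12 X : N1m X -> 0 < xi2 X -> reach (P12m R) X.
Proof.
move=> NX b0; pose Y := (xi2 X)^-1 *: X.
have b1 : xi2 Y = 1 by rewrite /= mulVf // lt0r_neq0.
have NY : N1m Y by apply: N1m_scale; rewrite ?invr_gt0.
have -> : X = xi2 X *: Y by rewrite scalerA divff ?scale1r // lt0r_neq0.
apply: reach_scale => //; move: Y b1 NY => {X NX b0} X b1 NX.
have [y0|y0] := eqVneq (x2 X) 0; first by apply: (@reach_P12_real _ 0).
set t := Num.sqrt (odot (x2 X) (x2 X)).
have tt : t ^+ 2 = odot (x2 X) (x2 X) by rewrite sqr_sqrtr ?odot_ge0.
have t0 : 0 < t.
  rewrite sqrtr_gt0 lt_neqAle odot_ge0 andbT eq_sym.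
  by apply: contra_neq y0; exact: odot_eq0.
(* The twist by this unit replaces [x2 X] by its norm [t]. *)
set u := t^-1 *: oconj (x2 X).
have u1 : odot u u = 1.
  rewrite odotZl odotZr odot_conj -tt; field; exact: lt0r_neq0.
rewrite -(twistK u1 X).
apply: reach_act; first by apply: Keps_twist; rewrite odot_conj.
apply: (@reach_P12_real _ t); rewrite ?ltW //.
  by apply: Keps_N1m => //; exact: Keps_twist.
rewrite /= omulZl omul_conjl -tt; congr Oct; rewrite ?mulr0 //.
by field; exact: lt0r_neq0.
Qed.

Lemma P12m_N1m : N1m (P12m R).
Proof.
split; [|by rewrite /jtr /=; ring|by rewrite jdot_E1 /=; lra].
congr h1; rewrite /= ?odotE /=; try by ring.
all: by rewrite ?(omul0l, omul0r) oconj0 ?scaler0 ?scale0r ?oppr0 addr0.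
Qed.

Lemma P13m_N1m : N1m (P13m R).
Proof.
split; [|by rewrite /jtr /=; ring|by rewrite jdot_E1 /=; lra].
congr h1; rewrite /= ?odotE /=; try by ring.
all: by rewrite ?(omul0l, omul0r) oconj0 ?scaler0 ?scale0r ?oppr0 addr0.
Qed.

(** [Keps_N1m] and the second hypothesis give one inclusion, and reachability gives the other,
    because [jclass] absorbs positive scalars. *)
Lemma KorbitE P (D : set (J1 R)) :
  N1m P -> (forall g, Keps g -> D (g P)) ->
  (forall X, N1m X -> D X -> reach P X) ->
  Korbit (jclass P) = [set jclass X | X in [set X | N1m X /\ D X]].
Proof.
move=> NP DP PD; apply/seteqP; split=> [_ [g gK <-]|_ [X [NX DX] <-]].
- exists (g P); first by split; [exact: Keps_N1m|exact: DP].
  by rewrite jact_class.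
- have [g gK [r r0 XE]] := PD X NX DX.
  by exists g => //; rewrite jact_class // XE jclass_scale.
Qed.

End Transitivity.

Theorem theorem9p7 (R : realType) :
  [/\ Fquot R = Korbit (jclass (P12m R)) `|` Korbit (jclass (P13m R)),
      Korbit (jclass (P12m R)) `&` Korbit (jclass (P13m R)) = set0,
      Korbit (jclass (P12m R))
        = [set jclass X | X in [set X | N1m X /\ jdot X (E2 R) != 0]],
      Korbit (jclass (P12m R))
        = [set jclass X | X in [set X | N1m X /\ 0 < jdot X (E2 R)]]
    & Korbit (jclass (P13m R))
        = [set jclass X | X in [set X | N1m X /\ jdot X (E2 R) = 0]]].
Proof.
have b_ge0 (X : J1 R) : N1m X -> 0 <= xi2 X by case/N1mP => _ _ [].
have orb12 : Korbit (jclass (P12m R))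
    = [set jclass X | X in [set X | N1m X /\ 0 < jdot X (E2 R)]].
  apply: (KorbitE (D := [set X | 0 < jdot X (E2 R)])) => [|g gK|X NX] /=.
  - exact: P12m_N1m.
  - by rewrite jdot_E2 Keps_xi2 //= ltr01.
  - by rewrite jdot_E2; exact: reach_P12.
have orb13 : Korbit (jclass (P13m R))
    = [set jclass X | X in [set X | N1m X /\ jdot X (E2 R) = 0]].
  apply: (KorbitE (D := [set X | jdot X (E2 R) = 0])) => [|g gK|X NX] /=.
  - exact: P13m_N1m.
  - by rewrite jdot_E2 Keps_xi2.
  - by rewrite jdot_E2; exact: reach_P13.
have neq0E : [set X : J1 R | N1m X /\ jdot X (E2 R) != 0]
    = [set X | N1m X /\ 0 < jdot X (E2 R)].
  apply/seteqP; split=> X [NX b]; split=> //; last exact: lt0r_neq0.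
  by rewrite lt_neqAle eq_sym b jdot_E2 b_ge0.
split=> //; last by rewrite neq0E.
- rewrite orb12 orb13; apply/seteqP; split=> [_ [X NX <-]|].
    have [b|b] := eqVneq (jdot X (E2 R)) 0; [right|left]; exists X => //.
    by split=> //; rewrite lt_neqAle eq_sym b jdot_E2 b_ge0.
  by move=> _ [] [X [NX _] <-]; exists X.
- rewrite orb12 orb13; apply/seteqP; split=> // c.
  move=> [[X [NX b0]] <-] [Y [NY c0] e].
  (* A common class would make [X] a positive multiple of [Y], although [xi2 X > 0] and
     [xi2 Y = 0]. *)
  have : jclass X X by split=> //; exists 1; rewrite ?scale1r.
  rewrite -e => -[_ [r _ XE]].
  by move: b0 c0; rewrite XE !jdot_E2 /= => + Y0; rewrite Y0 mulr0 ltxx.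
Qed.
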